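(* Let $A$ be a unital algebra over a field $k$, let $M$ be a unital $A$-bimodule, and let $K$ be a subspace of the trivial extension $A\ltimes M$. Let $Z\subseteq B\subseteq A$, $J\subseteq M$ and the linear surjection $\varphi:J\to B/Z$ be constructed from $K$ as in the context, so that $K=\{(a,-x)\in A\ltimes M\mid a\in B,\ x\in J,\ \varphi(x)=a+Z\}$. Then $K$ is an ideal of $A\ltimes M$ if and only if the following hold: (a) $B$ and $Z$ are ideals of $A$, and $B^2\subseteq Z$. (b) $J$ is an $A$-subbimodule of $M$. (c) $\varphi$ is an $A$-bimodule epimorphism, and $BM\subseteq\mathrm{Ker}(\varphi)$ and $MB\subseteq\mathrm{Ker}(\varphi)$.
   Context: Algebras are associative; ideals are two-sided. The trivial extension $A\ltimes M$ is the vector space $A\oplus M$ with multiplication $(a,x)(b,y)=(ab,\ ay+xb)$. For a subspace $K\subseteq A\ltimes M$ put $B=\{a\in A\mid (a,x)\in K\text{ for some }x\in M\}$, $J=\{x\in M\mid (a,x)\in K\text{ for some }a\in A\}$, $Z=\{a\in A\mid (a,0)\in K\}$. Then $Z\subseteq B$, and $\varphi:J\to B/Z\subseteq A/Z$, $\varphi(x)=a+Z$ whenever $(a,-x)\in K$, is a well-defined surjective linear map. Here $B^2$, $BM$, $MB$ denote the spans of the corresponding products. *)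

(* Defs.v *)
From HB Require Import structures.
From mathcomp Require Import all_boot all_algebra.
From mathcomp Require Import boolp classical_sets.

Set Implicit Arguments.
Unset Strict Implicit.
Unset Printing Implicit Defensive.

Import GRing.Theory.
Local Open Scope classical_set_scope.
Local Open Scope quotient_scope.
Local Open Scope ring_scope.

(* Subspaces are bundled boolean predicates ([submodClosed]).  Thanks to the  *)
(* classical axioms of [boolp], every [Prop]-valued predicate [P] has the     *)
(* boolean form [`[< P >]], so that all subspaces of a possibly infinite-     *)
(* dimensional space are covered.                                             *)

HB.mixin Record isBimodule (k : fieldType) (A : algType k) M
    of GRing.Lmodule k M := {
  lact : A -> M -> M;
  ract : M -> A -> M;
  lact_linearl : forall x (c : k) a b,
    lact (c *: a + b) x = c *: lact a x + lact b x;
  lact_linearr : forall a (c : k) x y,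
    lact a (c *: x + y) = c *: lact a x + lact a y;
  ract_linearl : forall a (c : k) x y,
    ract (c *: x + y) a = c *: ract x a + ract y a;
  ract_linearr : forall x (c : k) a b,
    ract x (c *: a + b) = c *: ract x a + ract x b;
  lact1 : forall x, lact 1 x = x;
  ract1 : forall x, ract x 1 = x;
  lactA : forall a b x, lact a (lact b x) = lact (a * b) x;
  ractA : forall a b x, ract (ract x a) b = ract x (a * b);
  lractA : forall a b x, ract (lact a x) b = lact a (ract x b)
}.

#[short(type="bimodType")]
HB.structure Definition Bimodule (k : fieldType) (A : algType k) :=
  {M of GRing.Lmodule k M & isBimodule k A M}.

Section BimoduleTheory.
Variables (k : fieldType) (A : algType k) (M : bimodType A).
Implicit Types (a b : A) (x y : M) (c : k).

Lemma lactDl x a b : lact (a + b) x = lact a x + lact b x.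
Proof. by have := lact_linearl x 1 a b; rewrite !scale1r. Qed.
Lemma lactDr a x y : lact a (x + y) = lact a x + lact a y.
Proof. by have := lact_linearr a 1 x y; rewrite !scale1r. Qed.
Lemma ractDl a x y : ract (x + y) a = ract x a + ract y a.
Proof. by have := ract_linearl a 1 x y; rewrite !scale1r. Qed.
Lemma ractDr x a b : ract x (a + b) = ract x a + ract x b.
Proof. by have := ract_linearr x 1 a b; rewrite !scale1r. Qed.
Lemma lact0l x : lact 0 x = 0.
Proof. by apply: (addrI (lact 0 x)); rewrite -lactDl !addr0. Qed.
Lemma lact0r a : lact a (0 : M) = 0.
Proof. by apply: (addrI (lact a 0)); rewrite -lactDr !addr0. Qed.
Lemma ract0l a : ract (0 : M) a = 0.
Proof. by apply: (addrI (ract 0 a)); rewrite -ractDl !addr0. Qed.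
Lemma ract0r x : ract x 0 = 0.
Proof. by apply: (addrI (ract x 0)); rewrite -ractDr !addr0. Qed.
Lemma lactZl c a x : lact (c *: a) x = c *: lact a x.
Proof. by have := lact_linearl x c a 0; rewrite lact0l !addr0. Qed.
Lemma lactZr c a x : lact a (c *: x) = c *: lact a x.
Proof. by have := lact_linearr a c x 0; rewrite lact0r !addr0. Qed.
Lemma ractZl c a x : ract (c *: x) a = c *: ract x a.
Proof. by have := ract_linearl a c x 0; rewrite ract0l !addr0. Qed.
Lemma ractZr c a x : ract x (c *: a) = c *: ract x a.
Proof. by have := ract_linearr x c a 0; rewrite ract0r !addr0. Qed.

End BimoduleTheory.

Definition is_ideal (k : fieldType) (R : algType k) (I : {pred R}) : Prop :=
  [/\ GRing.submod_closed I,
      forall a x, x \in I -> a * x \in I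
    & forall a x, x \in I -> x * a \in I].

Definition is_subbimodule (k : fieldType) (A : algType k) (M : bimodType A)
    (N : {pred M}) : Prop :=
  [/\ GRing.submod_closed N,
      forall a x, x \in N -> lact a x \in N
    & forall a x, x \in N -> ract x a \in N].

Definition is_bimod_hom (k : fieldType) (A : algType k) (M N : bimodType A)
    (f : M -> N) : Prop :=
  [/\ linear f,
      forall (a : A) x, f (lact a x) = lact a (f x)
    & forall (a : A) x, f (ract x a) = ract (f x) a].

Definition is_bimod_epi (k : fieldType) (A : algType k) (M N : bimodType A)
    (f : M -> N) : Prop :=
  is_bimod_hom f /\ forall y, exists x, f x = y.

Section Trivext.
Variables (k : fieldType) (A : algType k) (M : bimodType A).

Definition trivext : Type := (A * M)%type.

HB.instance Definition _ := GRing.Lmodule.copy trivext (A * M)%type.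

Definition trivext_one : trivext := (1, 0).
Definition trivext_mul (u v : trivext) : trivext :=
  (u.1 * v.1, lact u.1 v.2 + ract u.2 v.1).

Fact trivext_mulA : associative trivext_mul.
Proof.
move=> [a x] [b y] [c z]; rewrite /trivext_mul /=.
by rewrite mulrA lactDr lactA ractDl lractA ractA addrA.
Qed.
Fact trivext_mul1l : left_id trivext_one trivext_mul.
Proof.
by move=> [a x]; rewrite /trivext_mul /= mul1r lact1 ract0l addr0.
Qed.
Fact trivext_mul1r : right_id trivext_one trivext_mul.
Proof.
by move=> [a x]; rewrite /trivext_mul /= mulr1 ract1 lact0r add0r.
Qed.
Fact trivext_mulDl : left_distributive trivext_mul +%R.
Proof.
move=> [a x] [b y] [c z]; congr pair => /=; first exact: mulrDl.
by rewrite lactDl ractDl addrACA.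
Qed.
Fact trivext_mulDr : right_distributive trivext_mul +%R.
Proof.
move=> [a x] [b y] [c z]; congr pair => /=; first exact: mulrDr.
by rewrite lactDr ractDr addrACA.
Qed.
Fact trivext_one_neq0 : trivext_one != 0.
Proof. by apply/eqP => -[] /eqP; rewrite oner_eq0. Qed.

HB.instance Definition _ := GRing.Zmodule_isNzRing.Build trivext
  trivext_mulA trivext_mul1l trivext_mul1r trivext_mulDl trivext_mulDr
  trivext_one_neq0.

Fact trivext_scaleAl (c : k) (u v : trivext) : c *: (u * v) = c *: u * v.
Proof.
case: u v => [a x] [b y]; congr pair => /=; first exact: scalerAl.
by rewrite scalerDr lactZl ractZl.
Qed.
HB.instance Definition _ :=
  GRing.Lmodule_isLalgebra.Build k trivext trivext_scaleAl.

Fact trivext_scaleAr (c : k) (u v : trivext) : c *: (u * v) = u * (c *: v).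
Proof.
case: u v => [a x] [b y]; congr pair => /=; first exact: scalerAr.
by rewrite scalerDr lactZr ractZr.
Qed.
HB.instance Definition _ :=
  GRing.Lalgebra_isAlgebra.Build k trivext trivext_scaleAr.

End Trivext.

Arguments trivext {k A} M.

Section SubQuotientSpaces.
Variables (k : fieldType) (V : lmodType k) (N : submodClosed V).

Definition subspace : Type := {x : V | x \in N}.

HB.instance Definition _ := SubChoice.copy subspace {x : V | x \in N}.
HB.instance Definition _ := [SubChoice_isSubLmodule of subspace by <:].

Definition in_subspace (x : V) (xN : x \in N) : subspace :=
  exist (fun y => y \in N) x xN.

(* [submodClosed] records closure under addition and scaling only, whereas    *)
(* the quotient construction asks for closure under opposite.                 *)
Definition zmod_pred : {pred V} := N.

Fact zmod_pred_closed : zmod_closed zmod_pred.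
Proof.
split=> [|x y xN yN]; first exact: (rpred0 N).
by apply: (@rpredD _ N); rewrite -1?scaleN1r; [exact: xN|exact: (@rpredZ _ _ N)].
Qed.
HB.instance Definition _ := GRing.isZmodClosed.Build V zmod_pred
  zmod_pred_closed.

Definition quotspace : Type := Quotient.quot zmod_pred.

HB.instance Definition _ := GRing.Zmodule.copy quotspace (Quotient.quot zmod_pred).
HB.instance Definition _ := Quotient.copy quotspace (Quotient.quot zmod_pred).

Definition quot_pi (x : V) : quotspace := \pi_(Quotient.quot zmod_pred) x.

Lemma quot_piE x y : quot_pi x = quot_pi y <-> x - y \in N.
Proof.
rewrite -[x - y \in N]/(x - y \in zmod_pred) Quotient.idealrBE.
by split=> [e|/eqP//]; apply/eqP.
Qed.

Lemma quot_piK (q : quotspace) : quot_pi (repr q) = q.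
Proof. exact: reprK. Qed.

Lemma quot_piD x y : quot_pi (x + y) = quot_pi x + quot_pi y.
Proof. by rewrite /quot_pi raddfD. Qed.

Definition quot_scale (c : k) (q : quotspace) := quot_pi (c *: repr q).

Lemma quot_piZ c x : quot_scale c (quot_pi x) = quot_pi (c *: x).
Proof.
by apply/quot_piE; rewrite -scalerBr rpredZ//; apply/quot_piE/quot_piK.
Qed.

Fact quot_scaleA c d q : quot_scale c (quot_scale d q) = quot_scale (c * d) q.
Proof. by rewrite -(quot_piK q) !quot_piZ scalerA. Qed.
Fact quot_scale1 : left_id 1 quot_scale.
Proof. by move=> q; rewrite -(quot_piK q) quot_piZ scale1r. Qed.
Fact quot_scaleDr : right_distributive quot_scale +%R.
Proof.
move=> c p q; rewrite -(quot_piK p) -(quot_piK q).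
by rewrite -quot_piD !quot_piZ scalerDr quot_piD.
Qed.
Fact quot_scaleDl q : {morph quot_scale^~ q : c d / c + d}.
Proof.
by move=> c d; rewrite -(quot_piK q) !quot_piZ scalerDl quot_piD.
Qed.
HB.instance Definition _ := GRing.Zmodule_isLmodule.Build k quotspace
  quot_scaleA quot_scale1 quot_scaleDr quot_scaleDl.

Fact quot_pi_is_linear : linear quot_pi.
Proof. by move=> c x y; rewrite quot_piD -quot_piZ. Qed.
HB.instance Definition _ :=
  GRing.isLinear.Build k V quotspace _ quot_pi quot_pi_is_linear.

End SubQuotientSpaces.

Section Subbimodule.
Variables (k : fieldType) (A : algType k) (M : bimodType A).
Variables (N : submodClosed M) (hN : is_subbimodule N).

(* The vector space [subspace N], with the actions restricted from [M].       *)
Definition subbimod of is_subbimodule N : Type := subspace N.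
Local Notation S := (subbimod hN).

HB.instance Definition _ := GRing.SubLmodule.copy S (subspace N).

Fact subbimod_lact_in a (x : S) : lact a (val x) \in N.
Proof. by case: hN => _ + _; apply; apply: valP. Qed.
Fact subbimod_ract_in a (x : S) : ract (val x) a \in N.
Proof. by case: hN => _ _; apply; apply: valP. Qed.

Definition subbimod_lact (a : A) (x : S) : S :=
  Sub (lact a (val x)) (subbimod_lact_in a x).
Definition subbimod_ract (x : S) (a : A) : S :=
  Sub (ract (val x) a) (subbimod_ract_in a x).

Lemma val_subbimod_lact a x : val (subbimod_lact a x) = lact a (val x).
Proof. exact: SubK. Qed.
Lemma val_subbimod_ract a x : val (subbimod_ract x a) = ract (val x) a.
Proof. exact: SubK. Qed.
Let subbimodE := (val_subbimod_lact, val_subbimod_ract).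

Fact subbimod_lact_linearl x (c : k) a b :
  subbimod_lact (c *: a + b) x = c *: subbimod_lact a x + subbimod_lact b x.
Proof. by apply: val_inj; rewrite GRing.valD GRing.valZ !subbimodE lact_linearl. Qed.
Fact subbimod_lact_linearr a (c : k) x y :
  subbimod_lact a (c *: x + y) = c *: subbimod_lact a x + subbimod_lact a y.
Proof. by apply: val_inj; rewrite GRing.valD GRing.valZ !subbimodE GRing.valD GRing.valZ lact_linearr. Qed.
Fact subbimod_ract_linearl a (c : k) x y :
  subbimod_ract (c *: x + y) a = c *: subbimod_ract x a + subbimod_ract y a.
Proof. by apply: val_inj; rewrite GRing.valD GRing.valZ !subbimodE GRing.valD GRing.valZ ract_linearl. Qed.
Fact subbimod_ract_linearr x (c : k) a b :
  subbimod_ract x (c *: a + b) = c *: subbimod_ract x a + subbimod_ract x b.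
Proof. by apply: val_inj; rewrite GRing.valD GRing.valZ !subbimodE ract_linearr. Qed.
Fact subbimod_lact1 x : subbimod_lact 1 x = x.
Proof. by apply: val_inj; rewrite subbimodE lact1. Qed.
Fact subbimod_ract1 x : subbimod_ract x 1 = x.
Proof. by apply: val_inj; rewrite subbimodE ract1. Qed.
Fact subbimod_lactA a b x :
  subbimod_lact a (subbimod_lact b x) = subbimod_lact (a * b) x.
Proof. by apply: val_inj; rewrite !subbimodE lactA. Qed.
Fact subbimod_ractA a b x :
  subbimod_ract (subbimod_ract x a) b = subbimod_ract x (a * b).
Proof. by apply: val_inj; rewrite !subbimodE ractA. Qed.
Fact subbimod_lractA a b x :
  subbimod_ract (subbimod_lact a x) b = subbimod_lact a (subbimod_ract x b).
Proof. by apply: val_inj; rewrite !subbimodE lractA. Qed.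

HB.instance Definition _ := isBimodule.Build k A S
  subbimod_lact_linearl subbimod_lact_linearr
  subbimod_ract_linearl subbimod_ract_linearr
  subbimod_lact1 subbimod_ract1 subbimod_lactA subbimod_ractA subbimod_lractA.

End Subbimodule.

Section QuotientBimodule.
Variables (k : fieldType) (A : algType k).
Variables (I : submodClosed A) (hI : is_ideal I).

(* The vector space [A / I] for an ideal [I] of [A], with the [A]-actions     *)
(* [a (b + I) = a b + I] and [(b + I) a = b a + I]: see [quotbimod_lactE] and *)
(* [quotbimod_ractE].                                                         *)
Definition quotbimod of is_ideal I : Type := quotspace I.
Local Notation Q := (quotbimod hI).

HB.instance Definition _ := GRing.Lmodule.copy Q (quotspace I).

Definition quotbimod_lact (a : A) (q : Q) : Q :=
  quot_pi I (a * repr (q : quotspace I)).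
Definition quotbimod_ract (q : Q) (a : A) : Q :=
  quot_pi I (repr (q : quotspace I) * a).

Lemma quotbimod_lactE a b :
  quotbimod_lact a (quot_pi I b) = quot_pi I (a * b).
Proof.
apply/quot_piE; rewrite -mulrBr; case: hI => _ + _; apply.
exact/quot_piE/quot_piK.
Qed.
Lemma quotbimod_ractE a b :
  quotbimod_ract (quot_pi I b) a = quot_pi I (b * a).
Proof.
apply/quot_piE; rewrite -mulrBl; case: hI => _ _; apply.
exact/quot_piE/quot_piK.
Qed.

Let piK (q : Q) : {b | q = quot_pi I b}.
Proof. by exists (repr (q : quotspace I)); rewrite quot_piK. Qed.

Let piP (c : k) (a b : A) :
  c *: (quot_pi I a : Q) + (quot_pi I b : Q) = (quot_pi I (c *: a + b) : Q).
Proof. by rewrite linearP. Qed.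

Fact quotbimod_lact_linearl x (c : k) a b :
  quotbimod_lact (c *: a + b) x = c *: quotbimod_lact a x + quotbimod_lact b x.
Proof.
by have [d ->] := piK x; rewrite !quotbimod_lactE piP mulrDl scalerAl.
Qed.
Fact quotbimod_lact_linearr a (c : k) x y :
  quotbimod_lact a (c *: x + y) = c *: quotbimod_lact a x + quotbimod_lact a y.
Proof.
have [d ->] := piK x; have [e ->] := piK y.
by rewrite piP !quotbimod_lactE piP mulrDr scalerAr.
Qed.
Fact quotbimod_ract_linearl a (c : k) x y :
  quotbimod_ract (c *: x + y) a = c *: quotbimod_ract x a + quotbimod_ract y a.
Proof.
have [d ->] := piK x; have [e ->] := piK y.
by rewrite piP !quotbimod_ractE piP mulrDl scalerAl.
Qed.
Fact quotbimod_ract_linearr x (c : k) a b :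
  quotbimod_ract x (c *: a + b) = c *: quotbimod_ract x a + quotbimod_ract x b.
Proof.
by have [d ->] := piK x; rewrite !quotbimod_ractE piP mulrDr scalerAr.
Qed.
Fact quotbimod_lact1 x : quotbimod_lact 1 x = x.
Proof. by have [d ->] := piK x; rewrite quotbimod_lactE mul1r. Qed.
Fact quotbimod_ract1 x : quotbimod_ract x 1 = x.
Proof. by have [d ->] := piK x; rewrite quotbimod_ractE mulr1. Qed.
Fact quotbimod_lactA a b x :
  quotbimod_lact a (quotbimod_lact b x) = quotbimod_lact (a * b) x.
Proof. by have [d ->] := piK x; rewrite !quotbimod_lactE mulrA. Qed.
Fact quotbimod_ractA a b x :
  quotbimod_ract (quotbimod_ract x a) b = quotbimod_ract x (a * b).
Proof. by have [d ->] := piK x; rewrite !quotbimod_ractE mulrA. Qed.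
Fact quotbimod_lractA a b x :
  quotbimod_ract (quotbimod_lact a x) b = quotbimod_lact a (quotbimod_ract x b).
Proof.
by have [d ->] := piK x; rewrite !(quotbimod_lactE, quotbimod_ractE) mulrA.
Qed.

HB.instance Definition _ := isBimodule.Build k A Q
  quotbimod_lact_linearl quotbimod_lact_linearr
  quotbimod_ract_linearl quotbimod_ract_linearr
  quotbimod_lact1 quotbimod_ract1
  quotbimod_lactA quotbimod_ractA quotbimod_lractA.

End QuotientBimodule.

Section Construction.
Variables (k : fieldType) (A : algType k) (M : bimodType A).
Variable K : submodClosed (trivext M).

Definition B_of : {pred A} := [pred a | `[< exists x : M, (a, x) \in K >]].
Definition J_of : {pred M} := [pred x | `[< exists a : A, (a, x) \in K >]].
Definition Z_of : {pred A} := [pred a | (a, 0 : M) \in K].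

Let KP (c : k) (a b : A) (x y : M) : (a, x) \in K -> (b, y) \in K ->
  (c *: a + b, c *: x + y) \in K.
Proof. by move=> aK bK; apply: (@rpredD _ K _ _ (@rpredZ _ _ K c _ aK) bK). Qed.

Fact B_of_closed : GRing.submod_closed B_of.
Proof.
split; first by apply/asboolP; exists 0; exact: (rpred0 K).
move=> c a b /asboolP[x ax] /asboolP[y by_].
by apply/asboolP; exists (c *: x + y); apply: KP.
Qed.
HB.instance Definition _ := GRing.isSubmodClosed.Build k A B_of B_of_closed.

Fact J_of_closed : GRing.submod_closed J_of.
Proof.
split; first by apply/asboolP; exists 0; exact: (rpred0 K).
move=> c x y /asboolP[a ax] /asboolP[b by_].
by apply/asboolP; exists (c *: a + b); apply: KP.
Qed.
HB.instance Definition _ := GRing.isSubmodClosed.Build k M J_of J_of_closed.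

Fact Z_of_closed : GRing.submod_closed Z_of.
Proof.
split; first exact: (rpred0 K).
move=> c a b aZ bZ; rewrite inE.
by have := KP c aZ bZ; rewrite scaler0 addr0.
Qed.
HB.instance Definition _ := GRing.isSubmodClosed.Build k A Z_of Z_of_closed.

Lemma Z_sub_B : {subset Z_of <= B_of}.
Proof. by move=> a aZ; apply/asboolP; exists 0. Qed.

(* [B / Z] as a subspace of [A / Z] *)
Definition BZ_of : {pred quotspace Z_of} :=
  [pred q | `[< exists2 b, b \in B_of & q = quot_pi Z_of b >]].

Fact BZ_of_closed : GRing.submod_closed BZ_of.
Proof.
split; first by apply/asboolP; exists 0; rewrite ?linear0 ?rpred0.
move=> c p q /asboolP[a aB ->] /asboolP[b bB ->]; apply/asboolP.
by exists (c *: a + b); rewrite ?linearP// rpredD// rpredZ.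
Qed.
HB.instance Definition _ :=
  GRing.isSubmodClosed.Build k (quotspace Z_of) BZ_of BZ_of_closed.

Let KN (a : A) (x : M) : (a, x) \in K -> (- a, - x) \in K.
Proof.
move=> aK; have := KP (-1) aK (rpred0 K : (0 : A, 0 : M) \in K).
by rewrite !scaleN1r !addr0.
Qed.

Fact phi_subproof (x : subspace J_of) : exists q : subspace BZ_of,
  exists2 a : A, (a, - val x) \in K & val q = quot_pi Z_of a.
Proof.
have /asboolP[a /KN ax] : val x \in J_of by apply: valP.
have qP : quot_pi Z_of (- a) \in BZ_of.
  apply/asboolP; exists (- a) => //.
  by apply/asboolP; exists (- val x).
by exists (in_subspace qP); exists (- a).
Qed.

(* The linear surjection [J -> B / Z] sending [x] to [a + Z] for any [a] such *)
(* that [(a, - x)] is in [K]; [phiE] shows that the choice of [a] is          *)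
(* irrelevant.                                                                *)
Definition phi (x : subspace J_of) : subspace BZ_of := sval (cid (phi_subproof x)).

Lemma phiE (x : subspace J_of) (a : A) :
  (a, - val x) \in K -> val (phi x) = quot_pi Z_of a.
Proof.
rewrite /phi; case: cid => q /= [b bK ->] aK; apply/quot_piE.
rewrite inE; have := KP (-1) aK bK.
by rewrite !scaleN1r opprK subrr addrC.
Qed.

Lemma phi_linear : linear phi.
Proof.
move=> c x y; apply: val_inj; rewrite GRing.valD GRing.valZ.
have /asboolP[a /KN ax] : val x \in J_of by apply: valP.
have /asboolP[b /KN by_] : val y \in J_of by apply: valP.
rewrite (phiE ax) (phiE by_) -linearP; apply: phiE.
have := KP c ax by_; congr (_ \in K); congr pair.
by rewrite GRing.valD GRing.valZ opprD scalerN.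
Qed.
HB.instance Definition _ :=
  GRing.isLinear.Build k (subspace J_of) (subspace BZ_of) _ phi phi_linear.

Lemma phi_surj q : exists x, phi x = q.
Proof.
have /asboolP[b /asboolP[y by_] qb] : val q \in BZ_of by apply: valP.
have yJ : - y \in J_of by apply/asboolP; exists (- b); apply: KN.
exists (in_subspace yJ); apply: val_inj; rewrite qb; apply: phiE => /=.
by rewrite opprK.
Qed.

Lemma K_phiE (a : A) (y : M) : (a, y) \in K <->
  a \in B_of /\ exists x, y = - val x /\ val (phi x) = quot_pi Z_of a.
Proof.
split=> [aK|[aB [x [-> e]]]].
  split; first by apply/asboolP; exists y.
  have yJ : - y \in J_of by apply/asboolP; exists (- a); apply: KN.
  exists (in_subspace yJ); rewrite /= opprK; split=> //.
  by apply: phiE; rewrite /= opprK.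
have /asboolP[b /KN bx] : val x \in J_of by apply: valP.
move: e; rewrite (phiE bx) => /quot_piE; rewrite inE => zK.
have := KP (-1) zK bx; rewrite scaler0 add0r scaleN1r opprB.
by rewrite subrK.
Qed.

Fact BZ_of_subbimodule (hB : is_ideal B_of) (hZ : is_ideal Z_of) :
  is_subbimodule (BZ_of : {pred quotbimod hZ}).
Proof.
split; first exact: BZ_of_closed.
- move=> a q /asboolP[b bB ->]; apply/asboolP; exists (a * b).
    by case: hB => _ + _; apply.
  exact: quotbimod_lactE.
- move=> a q /asboolP[b bB ->]; apply/asboolP; exists (b * a).
    by case: hB => _ _; apply.
  exact: quotbimod_ractE.
Qed.

Definition JBimod (hJ : is_subbimodule J_of) : bimodType A := subbimod hJ.
Definition BZBimod (hB : is_ideal B_of) (hZ : is_ideal Z_of) : bimodType A :=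
  subbimod (BZ_of_subbimodule hB hZ).

Definition Ker_phi : set M :=
  [set x | exists2 j : subspace J_of, val j = x & phi j = 0].

End Construction.

Section Spans.
Variables (k : fieldType) (U V : Type) (W : lmodType k).

Definition lspan (S : set W) : set W :=
  [set w | exists (n : nat) (c : 'I_n -> k) (s : 'I_n -> W),
     (forall i, S (s i)) /\ w = \sum_i c i *: s i].

Definition prodspan (op : U -> V -> W) (P : {pred U}) (Q : {pred V}) : set W :=
  lspan [set w | exists u v, [/\ u \in P, v \in Q & w = op u v]].

End Spans.

(* Main.v *)
(* The proof rests on the identity                                            *)
(*   (a, x) (b, y) = (a b, 0) + (0, a y) + (0, x b)                           *)
(* and on Ker(phi) = {x | (0, x) \in K}.  If K is an ideal, multiplying its   *)
(* elements by 0 + M on either side shows that B M and M B lie in Ker(phi);   *)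
(* then for (b, x) in K and b' in B, both (b, x) (b', 0) = (b b', x b') and   *)
(* (0, x b') lie in K, so b b' is in Z.  Conversely, for (b, y) in K and      *)
(* (a, x) arbitrary, (a b, a y) lies in K by A-linearity of phi, and (0, x b) *)
(* because M B <= Ker(phi); symmetrically on the other side.                  *)
Require Import Defs.
From HB Require Import structures.
From mathcomp Require Import all_boot all_algebra.
From mathcomp Require Import boolp classical_sets.

Set Implicit Arguments.
Unset Strict Implicit.
Unset Printing Implicit Defensive.

Import GRing.Theory.
Local Open Scope classical_set_scope.
Local Open Scope ring_scope.

(** Up to sign, [K] is the preimage in $B\times J$ of the graph of $\varphi$ ([K_phiE]), so closure
    of [K] under products can be read off from $\varphi$. Since $(c,m)=(c,0)+(0,m)$, it splits in
    two. Multiplying by $(c,0)$ acts by $c$ on both coordinates, which matches [A]-linearity of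
    $\varphi$ ([phi_bimod_epi], [bimod_hom_memK_lact], [bimod_hom_memK_ract]). Multiplying by
    $(0,m)$ sends $(b,x)$ to $(0,mb)$ or $(0,bm)$, which matches $MB,
    BM\subseteq\mathrm{Ker}(\varphi)$ through [Ker_phiE]. *)

Section Span.
Variables (k : fieldType) (W : lmodType k).

Lemma lspan_incl (S : set W) : S `<=` lspan S.
Proof.
move=> w Sw; exists 1%N, (fun=> 1), (fun=> w).
by rewrite big_ord1 scale1r.
Qed.

Lemma lspan_sub (S T : set W) : GRing.submod_closed [pred w | `[< T w >]] ->
  S `<=` T -> lspan S `<=` T.
Proof.
move=> [T0 TP] ST w [n [c [s [Ss ->]]]].
apply: (big_ind T) => [|x y Tx Ty|i _]; first exact/asboolP.
- by apply/asboolP; rewrite -[x]scale1r; apply: TP; apply/asboolP.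
- by apply/asboolP; rewrite -[_ *: _]addr0; apply: TP => //; apply/asboolP/ST.
Qed.

Lemma mem_prodspan (U V : Type) (op : U -> V -> W) (P : {pred U}) (Q : {pred V})
    u v : u \in P -> v \in Q -> prodspan op P Q (op u v).
Proof. by move=> uP vQ; apply: lspan_incl; exists u, v. Qed.

Lemma prodspan_sub (U V : Type) (op : U -> V -> W) (P : {pred U}) (Q : {pred V})
    (T : set W) : GRing.submod_closed [pred w | `[< T w >]] ->
  (forall u v, u \in P -> v \in Q -> T (op u v)) -> prodspan op P Q `<=` T.
Proof.
by move=> Tcl PQT; apply: lspan_sub => // _ [u [v [uP vQ ->]]]; exact: PQT.
Qed.

End Span.

Section TrivextSubspace.
Variables (k : fieldType) (A : algType k) (M : bimodType A).
Variable K : submodClosed (trivext M).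
Implicit Types (a b : A) (x y : M).

Lemma memK_add a b x y :
  (a, x) \in K -> (b, y) \in K -> (a + b, x + y) \in K.
Proof. exact: (@rpredD _ K (a, x) (b, y)). Qed.

Lemma memK_opp a x : (a, x) \in K -> (- a, - x) \in K.
Proof.
by move=> aK; have := @rpredZ _ _ K (-1) _ aK; rewrite scaleN1r.
Qed.

(** Supplies a representative of $\varphi(j)$ in the signed form that [phiE] expects. *)
Lemma mem_J (j : subspace (J_of K)) : exists a, (a, - val j) \in K.
Proof. by have /asboolP[a /memK_opp aK] := valP j; exists (- a). Qed.

(** $\varphi(x)=0+Z$ says exactly that $(0,-x)\in K$, and the sign is absorbed because [K] is a
    subspace. *)
Lemma Ker_phiE x : Ker_phi K x <-> (0, x) \in K.
Proof.
split=> [[j <- j0]|xK].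
  have /memK_opp : (0, - val j) \in K.
    by apply/K_phiE; split; [exact: rpred0|exists j; rewrite j0 !linear0].
  by rewrite oppr0 opprK.
have xJ : x \in J_of K by apply/asboolP; exists 0.
exists (in_subspace xJ) => //; apply: val_inj.
rewrite (@phiE _ _ _ _ _ 0) ?linear0//.
by rewrite -oppr0; apply: memK_opp.
Qed.

Lemma Ker_phi_closed : GRing.submod_closed [pred x | `[< Ker_phi K x >]].
Proof.
split=> [|c x y]; first by apply/asboolP/Ker_phiE; exact: (rpred0 K).
move=> /asboolP/Ker_phiE xK /asboolP/Ker_phiE yK; apply/asboolP/Ker_phiE.
have := @rpredZ _ _ K c _ xK.
by move=> /memK_add/(_ yK); rewrite scaler0 addr0.
Qed.

Lemma Z_of_set_closed : GRing.submod_closed [pred a | `[< [set` Z_of K] a >]].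
Proof.
have -> : [pred a | `[< [set` Z_of K] a >]] = Z_of K :> {pred A}.
  by apply/funext => a /=; rewrite asboolb.
exact: Z_of_closed.
Qed.

Section Ideal.
Hypothesis idK : is_ideal K.

(** This is the product $(c,m)(a,x)$ in coordinates; it is used below with $m=0$ and with $c=0$. *)
Lemma idealK_mull c m a x : (a, x) \in K -> (c * a, lact c x + ract m a) \in K.
Proof. by case: idK => _ + _ aK => /(_ (c, m) _ aK). Qed.

Lemma idealK_mulr c m a x : (a, x) \in K -> (a * c, lact a m + ract x c) \in K.
Proof. by case: idK => _ _ + aK => /(_ (c, m) _ aK). Qed.

Lemma idealK_lact c a x : (a, x) \in K -> (c * a, lact c x) \in K.
Proof. by move=> /(idealK_mull c 0); rewrite ract0l addr0. Qed.

Lemma idealK_ract c a x : (a, x) \in K -> (a * c, ract x c) \in K.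
Proof. by move=> /(idealK_mulr c 0); rewrite lact0r add0r. Qed.

Lemma B_of_ideal : is_ideal (B_of K).
Proof.
split=> [|c a /asboolP[x aK]|c a /asboolP[x aK]]; first exact: B_of_closed.
- by apply/asboolP; exists (lact c x); exact: idealK_lact.
- by apply/asboolP; exists (ract x c); exact: idealK_ract.
Qed.

Lemma Z_of_ideal : is_ideal (Z_of K).
Proof.
split=> [|c a aK|c a aK]; first exact: Z_of_closed.
- by have := idealK_lact c aK; rewrite lact0r.
- by have := idealK_ract c aK; rewrite ract0l.
Qed.

Lemma J_of_subbimodule : is_subbimodule (J_of K).
Proof.
split=> [|c x /asboolP[a aK]|c x /asboolP[a aK]]; first exact: J_of_closed.
- by apply/asboolP; exists (c * a); exact: idealK_lact.
- by apply/asboolP; exists (a * c); exact: idealK_ract.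
Qed.

Lemma lact_B_Ker_phi b m : b \in B_of K -> Ker_phi K (lact b m).
Proof.
move=> /asboolP[x /(idealK_mulr 0 m)]; rewrite mulr0 ract0r addr0.
by move=> ?; apply/Ker_phiE.
Qed.

Lemma ract_B_Ker_phi m b : b \in B_of K -> Ker_phi K (ract m b).
Proof.
move=> /asboolP[x /(idealK_mull 0 m)]; rewrite mul0r lact0l add0r.
by move=> ?; apply/Ker_phiE.
Qed.

(** For $(a,x)\in K$, the pair $(ab,xb)$ is in [K] by the action of $b$, and $(0,xb)$ is in [K]
    because $MB\subseteq\mathrm{Ker}(\varphi)$; the difference is $(ab,0)$. *)
Lemma mul_B_Z a b : a \in B_of K -> b \in B_of K -> a * b \in Z_of K.
Proof.
move=> /asboolP[x aK] bB.
have /Ker_phiE/memK_opp := ract_B_Ker_phi x bB.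
by move=> /(memK_add (idealK_ract b aK)); rewrite oppr0 addr0 subrr.
Qed.

(** If $b$ represents $\varphi(x)$, then $(ab,-ax)\in K$, so $ab$ represents $\varphi(ax)$; likewise
    on the right. *)
Lemma phi_bimod_epi (hB : is_ideal (B_of K)) (hZ : is_ideal (Z_of K))
    (hJ : is_subbimodule (J_of K)) :
  is_bimod_epi (phi (K := K) : JBimod hJ -> BZBimod hB hZ).
Proof.
split; last exact: phi_surj.
split=> [|a x|a x]; first exact: phi_linear.
- have [b bK] := mem_J x.
  apply: val_inj; rewrite val_subbimod_lact (phiE bK).
  rewrite [RHS]quotbimod_lactE; apply: phiE; rewrite val_subbimod_lact.
  by have := idealK_lact a bK; rewrite -scaleN1r lactZr scaleN1r.
- have [b bK] := mem_J x.
  apply: val_inj; rewrite val_subbimod_ract (phiE bK).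
  rewrite [RHS]quotbimod_ractE; apply: phiE; rewrite val_subbimod_ract.
  by have := idealK_ract a bK; rewrite -scaleN1r ractZl scaleN1r.
Qed.

End Ideal.

Section BimoduleHom.
Variables (hB : is_ideal (B_of K)) (hZ : is_ideal (Z_of K)).
Variable hJ : is_subbimodule (J_of K).
Hypothesis phi_hom : is_bimod_hom (phi (K := K) : JBimod hJ -> BZBimod hB hZ).

(** With $x=-j$ and $\varphi(j)=a+Z$, linearity gives $\varphi(cj)=ca+Z$, which [K_phiE] turns back
    into membership in [K]. *)
Lemma bimod_hom_memK_lact c a x : (a, x) \in K -> (c * a, lact c x) \in K.
Proof.
move=> /K_phiE[aB [j [-> ja]]]; apply/K_phiE; split.
  by case: hB => _ + _; apply.
exists (lact c (j : JBimod hJ)); split.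
  rewrite [X in _ = - X](val_subbimod_lact c (j : JBimod hJ)).
  by rewrite -!scaleN1r lactZr.
case: phi_hom => _ -> _.
by rewrite [LHS](val_subbimod_lact c (phi j : BZBimod hB hZ)) ja; exact: quotbimod_lactE.
Qed.

Lemma bimod_hom_memK_ract c a x : (a, x) \in K -> (a * c, ract x c) \in K.
Proof.
move=> /K_phiE[aB [j [-> ja]]]; apply/K_phiE; split.
  by case: hB => _ _; apply.
exists (ract (j : JBimod hJ) c); split.
  rewrite [X in _ = - X](val_subbimod_ract c (j : JBimod hJ)).
  by rewrite -!scaleN1r ractZl.
case: phi_hom => _ _ ->.
by rewrite [LHS](val_subbimod_ract c (phi j : BZBimod hB hZ)) ja; exact: quotbimod_ractE.
Qed.

End BimoduleHom.
End TrivextSubspace.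

Theorem corollary4p3 (k : fieldType) (A : algType k) (M : bimodType A)
    (K : submodClosed (trivext M)) :
  is_ideal K <->
  exists (hB : is_ideal (B_of K)) (hZ : is_ideal (Z_of K))
         (hJ : is_subbimodule (J_of K)),
    [/\ prodspan *%R (B_of K) (B_of K) `<=` [set` Z_of K],
        is_bimod_epi (phi (K := K) : JBimod hJ -> BZBimod hB hZ),
        prodspan (@lact k A M) (B_of K) predT `<=` Ker_phi K
      & prodspan (@ract k A M) predT (B_of K) `<=` Ker_phi K].
Proof.
split=> [idK|[hB [hZ [hJ [_ [phi_hom _] BM MB]]]]].
  exists (B_of_ideal idK), (Z_of_ideal idK), (J_of_subbimodule idK).
  split.
  - by apply: prodspan_sub; [exact: Z_of_set_closed|exact: mul_B_Z].
  - exact: phi_bimod_epi.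
  - apply: prodspan_sub; first exact: Ker_phi_closed.
    by move=> b m bB _; exact: lact_B_Ker_phi.
  - apply: prodspan_sub; first exact: Ker_phi_closed.
    by move=> m b _ bB; exact: ract_B_Ker_phi.
have memB a x : (a, x) \in K -> a \in B_of K by move=> aK; apply/asboolP; exists x.
split=> [|[c m] [a x] aK|[c m] [a x] aK].
- by split=> [|c u v uK vK]; [exact: rpred0|rewrite rpredD// rpredZ].
(* $(c,m)(a,x)=(ca,cx)+(0,ma)$; the second summand is in [K] because
   $MB\subseteq\mathrm{Ker}(\varphi)$. *)
- have /Ker_phiE maK :=
    MB _ (mem_prodspan (@ract k A M) (isT : m \in predT) (memB _ _ aK)).
  have := memK_add (bimod_hom_memK_lact phi_hom c aK) maK.
  by rewrite addr0.
- have /Ker_phiE amK :=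
    BM _ (mem_prodspan (@lact k A M) (memB _ _ aK) (isT : m \in predT)).
  have := memK_add amK (bimod_hom_memK_ract phi_hom c aK).
  by rewrite add0r.
Qed.
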